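(* Let $(R,\mathfrak{m},k)$ be a Noetherian local ring and let $I$ be an ideal of $R$. Then the following hold: (a) $\sum_{j=0}^{2n+1}(-1)^{j+1}\beta_j^R(I)\geq -1$ for all integers $n\geq 0$; in particular $\beta_1^R(I)-\beta_0^R(I)\geq -1$. (b) If $R$ is unmixed and equality holds in (a), i.e. $\sum_{j=0}^{2n+1}(-1)^{j+1}\beta_j^R(I)=-1$ for some integer $n\geq 0$, then $\operatorname{grade}(I)>0$. (c) If $\operatorname{grade}(I)>0$, then $\sum_{j=0}^{2n}(-1)^{j+1}\beta_j^R(I)\leq -1$ for all integers $n\geq 0$.
   Context: For a finitely generated $R$-module $M$, $\beta_i^R(M)=\dim_k \operatorname{Tor}_i^R(k,M)$ is the $i$th Betti number of $M$; $\beta_i^R(I)$ is the Betti number of the ideal $I$ viewed as an $R$-module. A module is called unmixed if all its associated prime ideals have the same height; $R$ is unmixed if it is unmixed as an $R$-module. *)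

(* Defs.v *)
From HB Require Import structures.
From mathcomp Require Import all_boot all_order all_algebra.
From mathcomp Require Export ring_quotient.
From mathcomp Require Import boolp classical_sets constructive_ereal.

Set Implicit Arguments.
Unset Strict Implicit.
Unset Printing Implicit Defensive.

Import Order.TTheory GRing.Theory.
Local Open Scope ring_scope.

(** Conventions.  A (possibly improper) ideal of a commutative ring [R] is a
    submodule of the regular module [R^o], i.e. a term of [ideal R].  The
    library type [idealr R] consists of the proper ideals only, and
    [prime_idealr R] of the (proper) prime ideals.  Membership is boolean,
    which is no restriction in the presence of classical logic.
    Quantities valued in [nat] extended by infinity live in [\bar int]. *)

Notation ideal R := (GRing.SubmodClosed.type R^o).

Definition ideal_module (R : comNzRingType) (I : ideal R) : Type :=
  {x : R^o | x \in I}.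

HB.instance Definition _ (R : comNzRingType) (I : ideal R) :=
  [isSub of ideal_module I for @sval _ _].
HB.instance Definition _ (R : comNzRingType) (I : ideal R) :=
  [Choice of ideal_module I by <:].
HB.instance Definition _ (R : comNzRingType) (I : ideal R) :=
  [SubChoice_isSubLmodule of ideal_module I by <:].

Section Rings.
Variable R : comNzRingType.

Definition span_ideal (s : seq R) : set R :=
  [set x | exists c : nat -> R, x = \sum_(i < size s) c i * s`_i]%classic.

Definition noetherian : Prop :=
  forall J : ideal R, exists s : seq R,
    forall x : R, x \in J <-> span_ideal s x.

Definition maximal_ideal (m : idealr R) : Prop :=
  forall J : idealr R, {subset m <= J} -> J =i m.

(** [R] is local with maximal ideal [m]. *)
Definition local_with (m : idealr R) : Prop :=
  maximal_ideal m /\ forall m' : idealr R, maximal_ideal m' -> m' =i m.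

(** [k], via [pi], is the residue field [R / m]. *)
Definition residue_map (m : idealr R) (k : fieldType) (pi : {rmorphism R -> k})
    : Prop :=
  (forall y : k, exists x : R, pi x = y) /\
  (forall x : R, pi x = 0 <-> x \in m).

(** There is a chain of primes [q 0 < q 1 < ... < q n = p]. *)
Definition prime_chain (p : prime_idealr R) (n : nat) : Prop :=
  exists q : nat -> prime_idealr R,
    (forall i : nat, (i < n)%N ->
       {subset q i <= q i.+1} /\ ~ {subset q i.+1 <= q i}) /\
    q n =i p.

Definition height (p : prime_idealr R) : \bar int :=
  supremum 0%E [set (Posz n)%:E | n in prime_chain p]%classic.

Definition associated_prime (M : lmodType R) (p : prime_idealr R) : Prop :=
  exists x : M, forall r : R, r \in p <-> r *: x = 0.

Definition unmixed (M : lmodType R) : Prop :=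
  forall p q : prime_idealr R,
    associated_prime M p -> associated_prime M q -> height p = height q.

Definition regular_sequence (s : seq R) : Prop :=
  (forall i : nat, (i < size s)%N -> forall r : R,
     span_ideal (take i s) (r * s`_i) -> span_ideal (take i s) r) /\
  ~ span_ideal s 1.

(** The grade of [I] on [R]; the unit ideal has infinite grade. *)
Definition grade (I : ideal R) : \bar int :=
  if (1 : R) \in I then +oo%E
  else supremum 0%E
    [set (Posz (size s))%:E | s in
       [set s : seq R | regular_sequence s /\ {subset s <= I}]]%classic.

End Rings.

Section Betti.
Variables (R : comNzRingType) (M : lmodType R).

(** Data of a complex [... -> R^(rk 1) -> R^(rk 0) -> M -> 0], maps acting on
    row vectors from the right; [aug j] is the image in [M] of the [j]-th
    basis vector of [R^(rk 0)]. *)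
Record free_complex := FreeComplex {
  rk : nat -> nat;
  bd : forall i : nat, 'M[R]_(rk i.+1, rk i);
  aug : 'I_(rk 0) -> M
}.

Definition augmentation (F : free_complex) (u : 'rV[R]_(rk F 0)) : M :=
  \sum_j u 0 j *: aug j.

Definition free_resolution (F : free_complex) : Prop :=
  [/\ forall x : M, exists u, @augmentation F u = x,
      forall u, @augmentation F u = 0 <-> exists v, u = v *m bd F 0
    & forall i (u : 'rV[R]_(rk F i.+1)),
        u *m bd F i = 0 <-> exists v, u = v *m bd F i.+1].

(** A resolution of [M] by finite free modules; one exists whenever [M] is
    finitely generated over a Noetherian ring, and the value is junk if there
    is none. *)
Definition chosen_resolution : free_complex :=
  xget (FreeComplex (fun=> 0 : 'M[R]_(0, 0)) (fun=> 0 : M) : {classic _})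
    [set F : {classic free_complex} | free_resolution F]%classic.

Variables (k : fieldType) (pi : {rmorphism R -> k}).

(** Applying [k (x)_R _] to a map of finite free modules reduces its matrix
    along [pi], so [Tor_i^R(k, M)] is the homology of [tor_bd]: the row
    space of [tor_cycles i] modulo the row space of [tor_bd i]. *)
Definition tor_bd (F : free_complex) (i : nat) : 'M[k]_(rk F i.+1, rk F i) :=
  map_mx pi (bd F i).

Definition tor_cycles (F : free_complex) (i : nat) : 'M[k]_(rk F i) :=
  match i with
  | 0 => 1%:M
  | j.+1 => kermx (tor_bd F j)
  end.

Definition betti (i : nat) : nat :=
  \rank (tor_cycles chosen_resolution i) -
  \rank (tor_bd chosen_resolution i).

End Betti.

(* Main.v *)
Require Import Defs.
From HB Require Import structures.
From mathcomp Require Import all_boot all_order all_algebra.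
From mathcomp Require Import boolp classical_sets constructive_ereal.
From mathcomp Require Import zify ring.

Set Implicit Arguments.
Unset Strict Implicit.
Unset Printing Implicit Defensive.
Import Order.TTheory GRing.Theory.
Local Open Scope ring_scope.

(** Localize at a minimal prime [p]: the length over the Artinian ring [R_p] is
    additive, so for a free resolution of [I] the alternating sum of the Betti
    numbers [beta_0 - beta_1 + ...] up to degree [N], multiplied by the length of
    [R_p], is the length of [I_p] plus [(-1)^N t], where [t] is the length of the
    image of the [N]-th differential minus its rank over [k] times the length of
    [R_p].  One has [t >= 0] because invertible matrices over [k] lift to matrices
    with determinant outside [p].  Now (a) holds since [I_p] is contained in [R_p],
    and (c) since a nonzerodivisor in [I] makes their lengths equal.  Equality
    in (a) forces [I_p = R_p] for every minimal [p]; in an unmixed ring all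
    associated primes are minimal, so [I] contains a nonzerodivisor by prime
    avoidance, which is (b).

    Instead of localizing, lengths are computed with chains of submodules of
    the original module whose steps remain strict after localization at [p]. *)

(** * Submodules as sets, linear maps and linear combinations *)

Section Submodules.
Variables (R : comNzRingType) (V : lmodType R).

Definition submodule (N : set V) : Prop :=
  N 0 /\ forall a x y, N x -> N y -> N (a *: x + y).

Lemma submoduleD N x y : submodule N -> N x -> N y -> N (x + y).
Proof. by move=> [_ NS] Nx Ny; rewrite -[x]scale1r; apply: NS. Qed.

Lemma submoduleZ N a x : submodule N -> N x -> N (a *: x).
Proof. by move=> [N0 NS] Nx; rewrite -[_ *: _]addr0; apply: NS. Qed.

Lemma submoduleB N x y : submodule N -> N x -> N y -> N (x - y).
Proof.
by move=> NS Nx Ny; rewrite addrC -scaleN1r; apply: NS.2.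
Qed.

Lemma submodule_sum N (I : Type) (r : seq I) (F : I -> V) :
  submodule N -> (forall i, N (F i)) -> N (\sum_(i <- r) F i).
Proof.
by move=> NS NF; apply: big_ind => //; [exact: NS.1|move=> x y; exact: submoduleD].
Qed.

Lemma submodule0 : submodule [set 0]%classic.
Proof. by split=> // a x y -> ->; rewrite scaler0 addr0. Qed.

Lemma submoduleT : submodule setT.
Proof. by []. Qed.

Lemma submoduleI N M : submodule N -> submodule M -> submodule (N `&` M)%classic.
Proof.
move=> [N0 NS] [M0 MS]; split=> // a x y [Nx Mx] [Ny My].
by split; [apply: NS|apply: MS].
Qed.

Definition sum_submodule (N M : set V) : set V :=
  fun z => exists x y, [/\ N x, M y & z = x + y].

Lemma submodule_sumS N M : submodule N -> submodule M -> submodule (sum_submodule N M).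
Proof.
move=> [N0 NS] [M0 MS]; split=> [|a _ _ [x [y [Nx My ->]]] [x' [y' [Nx' My' ->]]]].
  by exists 0, 0; split=> //; rewrite addr0.
exists (a *: x + x'), (a *: y + y'); split; [exact: NS|exact: MS|].
by rewrite scalerDr addrACA.
Qed.

Lemma sum_submoduleSl N M : M 0 -> (N `<=` sum_submodule N M)%classic.
Proof. by move=> M0 x Nx; exists x, 0; split=> //; rewrite addr0. Qed.

Lemma sum_submoduleSr N M : N 0 -> (M `<=` sum_submodule N M)%classic.
Proof. by move=> N0 x Mx; exists 0, x; split=> //; rewrite add0r. Qed.

Definition cyclic_submodule (x : V) : set V := fun y => exists r, y = r *: x.

Lemma submodule_cyclic x : submodule (cyclic_submodule x).
Proof.
split=> [|a _ _ [r ->] [r' ->]]; first by exists 0; rewrite scale0r.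
by exists (a * r + r'); rewrite scalerDl scalerA.
Qed.

Lemma cyclic_submodule_id x : cyclic_submodule x x.
Proof. by exists 1; rewrite scale1r. Qed.

End Submodules.

Section LinearMaps.
Variables (R : comNzRingType) (U V : lmodType R) (f : {linear U -> V}).

Lemma submodule_preimage N : submodule N -> submodule (f @^-1` N)%classic.
Proof.
move=> [N0 NS]; split=> [|a x y Nx Ny]; first by rewrite /preimage /= linear0.
by rewrite /preimage /= linearP; apply: NS.
Qed.

Lemma submodule_image N : submodule N -> submodule (f @` N)%classic.
Proof.
move=> [N0 NS]; split=> [|a _ _ [x Nx <-] [y Ny <-]].
  by exists 0; rewrite ?linear0.
by exists (a *: x + y); [apply: NS|rewrite linearP].
Qed.

Lemma submodule_range : submodule (range f).
Proof. exact/submodule_image/submoduleT. Qed.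

Definition kernel : set U := (f @^-1` [set 0])%classic.

Lemma submodule_kernel : submodule kernel.
Proof. exact/submodule_preimage/submodule0. Qed.

End LinearMaps.

Section LinearCombination.
Variables (R : comNzRingType) (V : lmodType R) (n : nat) (x : 'I_n -> V).

(** Same body as [augmentation], now with a linear structure, so that results on kernels and ranges
    apply to augmentations by conversion. *)
Definition lincomb (u : 'rV[R]_n) : V := \sum_j u 0 j *: x j.

Lemma lincomb_is_linear : linear lincomb.
Proof.
move=> a u v; rewrite /lincomb scaler_sumr -big_split /=.
by apply: eq_bigr => j _; rewrite !mxE scalerDl scalerA.
Qed.

HB.instance Definition _ := GRing.isLinear.Build R 'rV[R]_n V _ lincomb
  lincomb_is_linear.

Lemma lincomb_delta j : lincomb (delta_mx 0 j) = x j.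
Proof.
rewrite /lincomb (bigD1 j) //= big1 ?addr0 => [|i /negPf ij].
  by rewrite mxE !eqxx scale1r.
by rewrite mxE ij andbF scale0r.
Qed.

End LinearCombination.

(** The exact sequence from [R^n] through [R^(n+1)] to [R], projecting on the first coordinate; it
    drives the inductions on the rank for lengths and for finite generation. *)
Lemma free_module_split (R : comNzRingType) (n : nat) :
  exists (f : {linear 'rV[R]_n.+1 -> R^o}) (g : {linear 'rV[R]_n -> 'rV[R]_n.+1}),
  [/\ range f = setT, kernel f = range g & forall u, g u = 0 -> u = 0].
Proof.
pose f : {linear 'rV[R]_n.+1 -> R^o} := lincomb (fun j => (j == ord0)%:R : R^o).
pose g : {linear 'rV[R]_n -> 'rV[R]_n.+1} := mulmxr (row_mx (0 : 'M_(n, 1)) 1%:M).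
have fE u : f u = u 0 ord0.
  rewrite /f /= /lincomb (bigD1 ord0) //= big1 ?addr0 => [|j /negPf->].
    by rewrite [LHS]mulr1.
  by rewrite scaler0.
have gE u : g u = (row_mx 0 u : 'rV_(1 + n))
  by rewrite -[LHS]/(u *m row_mx (0 : 'M_(n, 1)) 1%:M) mul_mx_row mulmx0 mulmx1.
have fT : range f = setT.
  by rewrite predeqE => x; split=> // _; exists (const_mx x); rewrite ?fE ?mxE.
have gk : kernel f = range g.
  rewrite predeqE => u; rewrite /kernel /preimage /mkset fE; split=> [u0|[v _ <-]].
    have lu : lsubmx (u : 'rV_(1 + n)) = 0.
      apply/rowP => i; rewrite !mxE !ord1 -[RHS]u0.
      by congr (u _ _); apply: val_inj.
    exists (rsubmx (u : 'rV_(1 + n))) => //; rewrite gE.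
    by have := hsubmxK (u : 'rV_(1 + n)); rewrite lu.
  rewrite gE; have -> : ord0 = lshift n (ord0 : 'I_1) by apply: val_inj.
  by rewrite (row_mxEl (0 : 'rV_1) v) mxE.
exists f, g; split=> // u gu0.
have -> : u = rsubmx (row_mx (0 : 'rV_1) u) by rewrite row_mxKr.
by rewrite -gE gu0; apply/rowP => i; rewrite !mxE.
Qed.

(** * Prime ideals and maximal elements in a Noetherian ring *)

Section Ideals.
Variable R : comNzRingType.
Implicit Types (J P Q : set R^o).

Definition is_prime P : Prop :=
  [/\ submodule P, ~ P 1 & forall a b : R, P (a * b) -> P a \/ P b].

Definition minimal_prime P : Prop :=
  is_prime P /\ forall Q, is_prime Q -> (Q `<=` P)%classic -> (P `<=` Q)%classic.

Lemma submodule_mem (J : ideal R) : submodule (fun x : R^o => x \in J).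
Proof.
split; first exact: rpred0.
by move=> a x y xJ yJ; apply: rpredD => //; apply: rpredZ.
Qed.

Lemma submodule_idealr (J : idealr R) : submodule (fun x : R^o => x \in J).
Proof.
split; first exact: rpred0.
by move=> a x y xJ yJ; apply: rpredD => //; apply: idealMr.
Qed.

Lemma is_prime_prime_idealr (P : prime_idealr R) : is_prime (fun x : R^o => x \in P).
Proof.
split; first exact: (submodule_idealr P).
- by rewrite idealr1.
- by move=> a b; rewrite prime_idealrM => /orP.
Qed.

Lemma ideal_of_submodule J : submodule J ->
  exists J' : ideal R, forall x, x \in J' <-> J x.
Proof.
move=> JS; pose S := (fun x : R^o => `[<J x>]).
have SP x : S x <-> J x by split=> /asboolP.
have SS : GRing.subsemimod_closed S.
  split; first split.
  - by apply/asboolP; exact: JS.1.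
  - by move=> x y /asboolP Jx /asboolP Jy; apply/asboolP; exact: submoduleD.
  - by move=> a x /asboolP Jx; apply/asboolP; exact: submoduleZ.
pose m := GRing.isSubmodClosed.Build R R^o S SS.
pose J' : ideal R := HB.pack S m.
by exists J'.
Qed.

Lemma idealr_of_submodule J : submodule J -> ~ J 1 ->
  exists J' : idealr R, forall x, x \in J' <-> J x.
Proof.
move=> JS J1; pose S := (fun x : R => `[<J x>]).
have SP x : S x <-> J x by split=> /asboolP.
have SS : idealr_closed S.
  split; first by apply/asboolP; exact: JS.1.
  - by apply/asboolP.
  - by move=> a u v /asboolP Ju /asboolP Jv; apply/asboolP; exact: JS.2.
pose m := isIdealr.Build R S SS.
pose J' : idealr R := HB.pack S m.
by exists J'.
Qed.

Lemma prime_idealr_of_is_prime P : is_prime P ->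
  exists P' : prime_idealr R, forall x, x \in P' <-> P x.
Proof.
move=> [PS P1 PM]; pose S := (fun x : R => `[<P x>]).
have SP x : S x <-> P x by split=> /asboolP.
have SS : idealr_closed S.
  split; first by apply/asboolP; exact: PS.1.
  - by apply/asboolP.
  - by move=> a u v /asboolP Ju /asboolP Jv; apply/asboolP; exact: PS.2.
have SM : prime_idealr_closed S.
  by move=> a b /asboolP/PM[Pa|Pb]; apply/orP; [left|right]; apply/asboolP.
pose m := isIdealr.Build R S SS.
pose m' := isPrimeIdealrClosed.Build R S SM.
pose P' : prime_idealr R := HB.pack S m m'.
by exists P'.
Qed.

Lemma span_ideal_nth (s : seq R) i : (i < size s)%N -> span_ideal s s`_i.
Proof.
move=> lt_is; exists (fun j => (j == i)%:R).
rewrite (bigD1 (Ordinal lt_is)) //= eqxx mul1r big1 ?addr0 // => j.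
by rewrite -val_eqE /= => /negPf->; rewrite mul0r.
Qed.

Lemma span_ideal_submodule (s : seq R) J : submodule J ->
  (forall i, (i < size s)%N -> J s`_i) -> (span_ideal s `<=` J)%classic.
Proof.
move=> JS Js _ [c ->]; apply: (@submodule_sum R R^o J) => // i.
exact: (submoduleZ (c i) JS (Js _ (ltn_ord i))).
Qed.

Hypothesis noethR : noetherian R.

Lemma noetherian_submodule J : submodule J ->
  exists s : seq R, forall x, J x <-> span_ideal s x.
Proof.
move=> /ideal_of_submodule[J' J'P]; have [s sP] := noethR J'.
by exists s => x; rewrite -J'P.
Qed.

(** Otherwise choosing strictly larger members forever gives an ascending chain; its union is an
    ideal whose finitely many generators already lie in one member, where the chain stops
    growing. *)
Lemma noetherian_maximal (F : set (set R^o)) :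
    (exists J, F J) -> (forall J, F J -> submodule J) ->
  exists2 J, F J & forall J', F J' -> (J `<=` J')%classic -> (J' `<=` J)%classic.
Proof.
move=> [J0 FJ0] FS; apply: contrapT => nomax.
have next J : exists J', F J -> [/\ F J', (J `<=` J')%classic & ~ (J' `<=` J)%classic].
  have [FJ|] := pselect (F J); last by move=> ?; exists J.
  apply: contrapT => noJ'; apply: nomax; exists J => // J' FJ' JJ'.
  by apply: contrapT => J'J; apply: noJ'; exists J'.
have [f fP] := choice next; pose u n := iter n f J0.
have Fu n : F (u n) by elim: n => //= n /fP[].
have uS n : (u n `<=` u n.+1)%classic by have [] := fP _ (Fu n).
have umono a b : (a <= b)%N -> (u a `<=` u b)%classic.
  move=> /subnK<-; elim: (b - a)%N => // d IH.
  exact: subset_trans IH (uS _).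
pose J : set R^o := fun x => exists n, u n x.
have JS : submodule J.
  split=> [|a x y [n ux] [n' uy]]; first by exists 0%N; exact: (FS _ FJ0).1.
  exists (maxn n n'); apply: (FS _ (Fu _)).2.
    exact: umono (leq_maxl _ _) _ ux.
  exact: umono (leq_maxr _ _) _ uy.
have [s sP] := noetherian_submodule JS.
have [n un] : exists n, forall i, (i < size s)%N -> u n s`_i.
  elim: {-2}(size s) (leqnn (size s)) => [|m IH] lm; first by exists 0%N.
  have [n un] := IH (ltnW lm).
  have [n' un'] : J s`_m by apply/sP; exact: span_ideal_nth.
  exists (maxn n n') => i; rewrite ltnS leq_eqVlt => /predU1P[->|im].
    exact: umono (leq_maxr _ _) _ un'.
  exact: umono (leq_maxl _ _) _ (un _ im).
have [_ _] := fP _ (Fu n); apply => x ux.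
have /sP : J x by exists n.+1.
exact: span_ideal_submodule (FS _ (Fu n)) un _.
Qed.

(* With [S = {1}] the prime is an arbitrary associated prime of [R / J]; with [S]
   the complement of a prime [q] it is one contained in [q]. *)
Lemma prime_colon (S : set R) J :
    S 1 -> (forall a b, S a -> S b -> S (a * b)) -> submodule J ->
    (forall s, S s -> ~ J s) ->
  exists2 x : R, forall s, S s -> ~ J (s * x) & is_prime (fun a => J (a * x)).
Proof.
move=> S1 SM JS SJ; pose adm x := forall s, S s -> ~ J (s * x).
pose col (x : R) : set R^o := fun a => J (a * x).
have colS x : submodule (col x).
  split=> [|a b c Jb Jc]; first by rewrite /col mul0r; exact: JS.1.
  by rewrite /col mulrDl -mulrA; exact: JS.2.
have colSl x a : (col x `<=` col (a * x)%R)%classic.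
  by move=> b Jb; rewrite /col mulrCA; exact: submoduleZ.
pose F J' := exists2 x, adm x & J' = col x.
have [||_ [x ax ->] xmax] := @noetherian_maximal F.
- by exists (col 1), 1 => // s Ss; rewrite mulr1; exact: SJ.
- by move=> _ [x _ ->].
(* A maximal colon ideal [(J : x)] is prime. If [b * x] is admissible, [(J : b x)] contains [a] and
   equals [(J : x)] by maximality. Otherwise some [s * (b * x)] is in [J], and the same holds for
   [b] and [(J : s x)]. *)
exists x => //; split=> [||a b Jab]; first exact: colS.
  by rewrite mul1r -[x]mul1r; exact: ax.
have [axb|naxb] := pselect (adm (b * x)).
  left; apply: (xmax (col (b * x))); [by exists (b * x)|exact: colSl|].
  by rewrite /col mulrA.
right; have [s [Ss Jsbx]] : exists s, S s /\ J (s * (b * x)).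
  apply: contrapT => ns; apply: naxb => s Ss Js; apply: ns; by exists s.
apply: (xmax (col (s * x))); [exists (s * x) => //| exact: colSl|].
  by move=> t St; rewrite mulrA; exact/ax/SM.
by rewrite /col mulrCA.
Qed.

(** Zorn's lemma applied to the sets [C] whose removal from [P] leaves a prime: a maximal [C] leaves
    a minimal prime, since a smaller prime [Q] would make the complement of [Q] a larger removable
    set. *)
Lemma prime_below P : is_prime P ->
  exists2 Q, minimal_prime Q & (Q `<=` P)%classic.
Proof.
move=> PP.
have [F FF Ftot|C [CP Cmax]] :=
    @Zorn_bigcup R (fun C => is_prime (P `&` ~` C)%classic).
  (* The empty set joins the chain so that an element outside [P] also has a witness [X]. *)
  have FF0 X : F X \/ X = set0 -> is_prime (P `&` ~` X)%classic.
    by case=> [/FF//|->]; rewrite setC0 setIT.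
  have split_out (a : R) : ~ (P `&` ~` \bigcup_(X in F) X)%classic a ->
      exists2 X, F X \/ X = set0 & ~ (P `&` ~` X)%classic a.
    move=> na; have [Pa|nPa] := pselect (P a); last first.
      by exists set0; [right|case].
    apply: contrapT => nX; apply: na; split=> // -[X FX Xa].
    by apply: nX; exists X; [left|case].
  have [PS P1 PM] := PP; split.
  - split=> [|a x y [Px Fx] [Py Fy]].
      split; first exact: PS.1.
      by move=> [X FX X0]; have [[[_]]] := FF X FX; exact.
    split; first exact: PS.2.
    move=> [X FX]; have [[_ XS] _ _] := FF X FX.
    apply: (XS a x y _ _).2; split=> // ?; [apply: Fx|apply: Fy]; by exists X.
  - by case.
  - move=> a b ab; apply: contrapT => /not_orP[/split_out[X FX Xa] /split_out[Y FY Yb]].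
    have [Z FZ [Za Zb]] : exists2 Z, F Z \/ Z = set0 &
        ~ (P `&` ~` Z)%classic a /\ ~ (P `&` ~` Z)%classic b.
      have [XY|YX] : (X `<=` Y)%classic \/ (Y `<=` X)%classic.
        case: FX FY => [FX|->] [FY|->]; [exact: Ftot|by right|by left|by left].
      - exists Y => //; split=> // -[Pa Ya]; apply: Xa; split=> // /XY; exact: Ya.
      - exists X => //; split=> // -[Pb Xb]; apply: Yb; split=> // /YX; exact: Xb.
    have [_ _ ZM] := FF0 Z FZ.
    have : (P `&` ~` Z)%classic (a * b).
      split; first by case: ab.
      case: FZ => [FZ Zab|-> //]; case: ab => _; apply; by exists Z.
    by case/ZM.
exists (P `&` ~` C)%classic; last by move=> x [].
split=> // Q PQ QP x [Px Cx]; apply: contrapT => nQx.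
apply: (Cmax (~` Q)%classic).
  split=> [y Cy Qy|CQ]; first by have [_] := QP y Qy; exact.
  by apply: Cx; apply: CQ.
rewrite setCK; suff -> : (P `&` Q = Q)%classic by [].
by rewrite predeqE => y; split=> [[]//|Qy]; split=> //; have [] := QP y Qy.
Qed.

(** With [S] the complement of [P], [prime_colon] gives a prime annihilator contained in [P];
    minimality makes it all of [P]. *)
Lemma minimal_prime_ann P : minimal_prime P ->
  exists x : R, forall a, P a <-> a * x = 0.
Proof.
move=> [PP Pmin]; have [PS P1 PM] := PP.
have [||||x xP xprime] := @prime_colon (~` P)%classic [set 0]%classic.
- by [].
- by move=> a b nPa nPb /PM[].
- exact: submodule0.
- by move=> s nPs s0; apply: nPs; rewrite s0; exact: PS.1.
exists x => a; split; last first.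
  by move=> ax; apply: contrapT => nPa; apply: (xP a).
apply: Pmin xprime _ a => a ax; apply: contrapT => nPa; exact: (xP a).
Qed.

End Ideals.

(** * Length after localization at a prime, computed by chains *)

Section Length.
Variables (R : comNzRingType) (p : set R^o).
Hypothesis pP : is_prime p.

(** For submodules with [N] inside [M]: some element of [M] has nonzero image in the localization of
    [M / N] at [p]. *)
Definition local_lt (V : lmodType R) (N M : set V) : Prop :=
  exists2 x, M x & forall s, ~ p s -> ~ N (s *: x).

(** [n] counts the strict steps; the final inclusion into [M] may be an equality. *)
Fixpoint chain (V : lmodType R) (n : nat) (N M : set V) : Prop :=
  if n is n'.+1 then
    exists P, [/\ submodule P, (N `<=` P)%classic, local_lt N P & chain n' P M]
  else (N `<=` M)%classic.

Definition finite_length (V : lmodType R) (N M : set V) : Prop :=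
  exists l, forall n, chain n N M -> (n <= l)%N.

(* The length of the localization of [M / N] at [p]. *)
Definition length (V : lmodType R) (N M : set V) : nat :=
  xget 0%N [set l | chain l N M /\ forall n, chain n N M -> (n <= l)%N]%classic.

Lemma prime_notin1 : ~ p 1. Proof. by case: pP. Qed.

Lemma prime_notinM s t : ~ p s -> ~ p t -> ~ p (s * t).
Proof. by case: pP => _ _ pM ns nt /pM[]. Qed.

Section Chains.
Variable V : lmodType R.
Implicit Types N M P Q C : set V.

Lemma chain_sub n N M : chain n N M -> (N `<=` M)%classic.
Proof.
by elim: n N => //= n IH N [P [_ NP _ /IH]]; exact: subset_trans.
Qed.

Lemma chain_subl n N' N M : (N' `<=` N)%classic -> chain n N M -> chain n N' M.
Proof.
case: n => [|n] /= N'N; first exact: subset_trans.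
case=> P [PS NP [x Px xN] PM]; exists P; split=> //; first exact: subset_trans NP.
by exists x => // s /xN + /N'N.
Qed.

Lemma chain_subr n N M M' : (M `<=` M')%classic -> chain n N M -> chain n N M'.
Proof.
move=> MM'; elim: n N => [|n IH] N /=; first by move=> NM; exact: subset_trans MM'.
by case=> P [PS NP ltNP /IH]; exists P.
Qed.

Lemma chain_cat a b N M Q : chain a N M -> chain b M Q -> chain (a + b) N Q.
Proof.
elim: a N => [|a IH] N /=; first exact: chain_subl.
by case=> P [PS NP ltNP /IH{}IH] /IH; exists P.
Qed.

(* The modular law: a strict step [C < P] stays strict after intersecting with [M]
   or after adding [M]. *)
Lemma chain_modular n C M Q :
    submodule C -> submodule M -> submodule Q -> (M `<=` Q)%classic -> chain n C Q ->
  exists a b, [/\ n = (a + b)%N, chain a (C `&` M)%classic M &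
                  chain b (sum_submodule C M) Q].
Proof.
move=> + MS QS MQ; elim: n C => [|n IH] C CS /=.
  move=> CQ; exists 0%N, 0%N; split=> //; first by move=> x [].
  move=> _ [x [y [/CQ Cx /MQ My ->]]].
  exact: submoduleD.
case=> P [PS CP [x Px xC] PQ]; have [a [b [-> aP bP]]] := IH P PS PQ.
have CPM : (C `&` M `<=` P `&` M)%classic by move=> y [/CP].
have CPM' : (sum_submodule C M `<=` sum_submodule P M)%classic.
  by move=> _ [y [z [/CP Py Mz ->]]]; exists y, z.
(* If some [s] outside [p] moves [x] into [C + M], the [M]-component of [s *: x] witnesses
   strictness of the intersections with [M]; otherwise [x] itself witnesses strictness of the
   sums. *)
have [[s [ps [c [y [Cc My sx]]]]]|ns] :=
    pselect (exists s, ~ p s /\ sum_submodule C M (s *: x)).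
- exists a.+1, b; split=> //; last exact: chain_subl bP.
  exists (P `&` M)%classic; split=> //; first exact: submoduleI.
  have yE : y = s *: x - c by rewrite sx addrC addKr.
  exists y; first by split=> //; rewrite yE; apply: submoduleB (submoduleZ _ _ _) (CP _ Cc).
  move=> t pt [Cty _]; apply: (xC (t * s)); first exact: prime_notinM.
  by rewrite -scalerA sx scalerDr; apply: submoduleD Cty => //; exact: submoduleZ.
- exists a, b.+1; split; [by rewrite addnS|exact: chain_subl aP|].
  exists (sum_submodule P M); split=> //; first exact: submodule_sumS.
  exists x; first by apply: sum_submoduleSl Px; exact: MS.1.
  by move=> s ps sx; apply: ns; exists s.
Qed.

Lemma chain_split n N M Q :
    submodule N -> submodule M -> submodule Q -> (N `<=` M)%classic ->
    (M `<=` Q)%classic -> chain n N Q ->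
  exists a b, [/\ n = (a + b)%N, chain a N M & chain b M Q].
Proof.
move=> NS MS QS NM MQ /(chain_modular NS MS QS MQ)[a [b [nE aP bP]]].
exists a, b; split=> //; first by apply: chain_subl aP => x Nx; split=> //; exact: NM.
by apply: chain_subl bP; apply: sum_submoduleSr; exact: NS.1.
Qed.

Lemma lengthP N M : (N `<=` M)%classic -> finite_length N M ->
  chain (length N M) N M /\ forall n, chain n N M -> (n <= length N M)%N.
Proof.
move=> NM [l lP].
pose S := [set l | chain l N M /\ forall n, chain n N M -> (n <= l)%N]%classic.
suff : S (length N M) by [].
apply: xgetPex.
pose b n := `[<chain n N M>].
have b0 : exists n, b n by exists 0%N; apply/asboolP.
have bl n : b n -> (n <= l)%N by move=> /asboolP/lP.
case: (ex_maxnP b0 bl) => k /asboolP kP kmax; exists k; split=> // n nP.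
by apply: kmax; apply/asboolP.
Qed.

Lemma lengthE N M l : chain l N M -> (forall n, chain n N M -> (n <= l)%N) ->
  length N M = l.
Proof.
move=> lP lmax; have [||c m] := @lengthP N M; [exact: chain_sub lP|by exists l|].
by apply/eqP; rewrite eqn_leq lmax // m.
Qed.

Lemma finite_lengthD N M Q :
    submodule N -> submodule M -> submodule Q -> (N `<=` M)%classic ->
    (M `<=` Q)%classic -> finite_length N M -> finite_length M Q ->
  finite_length N Q.
Proof.
move=> NS MS QS NM MQ [k kP] [l lP]; exists (k + l)%N => n.
case/(chain_split NS MS QS NM MQ) => [a [b [-> /kP ak /lP bl]]]; exact: leq_add.
Qed.

Lemma finite_length_sub N N' M M' : (N `<=` N')%classic -> (M' `<=` M)%classic ->
  finite_length N M -> finite_length N' M'.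
Proof.
move=> NN' MM' [k kP]; exists k => n nP; apply: kP.
exact: chain_subr MM' (chain_subl NN' nP).
Qed.

Lemma lengthD N M Q :
    submodule N -> submodule M -> submodule Q -> (N `<=` M)%classic ->
    (M `<=` Q)%classic -> finite_length N Q ->
  length N Q = (length N M + length M Q)%N.
Proof.
move=> NS MS QS NM MQ NQ.
have [c1 m1] := lengthP NM (finite_length_sub (@subset_refl _ _) MQ NQ).
have [c2 m2] := lengthP MQ (finite_length_sub NM (@subset_refl _ _) NQ).
apply: lengthE; first exact: chain_cat c1 c2.
by move=> n /(chain_split NS MS QS NM MQ)[a [b [-> /m1 ak /m2 bl]]]; exact: leq_add.
Qed.

Lemma chain_gt0 n N M : chain n.+1 N M -> exists2 x, M x & forall s, ~ p s -> ~ N (s *: x).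
Proof.
by case=> P [_ _ [x Px xN] /chain_sub PM]; exists x => //; exact: PM.
Qed.

Lemma torsion_chain n N M :
  (forall x, M x -> exists2 s, ~ p s & N (s *: x)) -> chain n N M -> n = 0%N.
Proof.
by case: n => // n tors /chain_gt0[x /tors[s ps Nsx] /(_ s ps)].
Qed.

Lemma torsion_finite_length N M :
  (forall x, M x -> exists2 s, ~ p s & N (s *: x)) -> finite_length N M.
Proof. by move=> tors; exists 0%N => n /(torsion_chain tors)->. Qed.

Lemma length_torsion N M : (N `<=` M)%classic ->
  (forall x, M x -> exists2 s, ~ p s & N (s *: x)) -> length N M = 0%N.
Proof. by move=> NM tors; apply: lengthE => // n /(torsion_chain tors)->. Qed.

Lemma length_gt0 N M x : submodule M -> (N `<=` M)%classic -> finite_length N M -> M x ->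
  (forall s, ~ p s -> ~ N (s *: x)) -> (0 < length N M)%N.
Proof.
move=> MS NM finNM Mx xN; have [_ -> //] := lengthP NM finNM.
by exists M; split=> //; exists x.
Qed.

(* The localization of [(N + R x) / N] is a quotient of the residue field at [p]. *)
Lemma finite_length_cyclic N x : submodule N -> (forall a, p a -> N (a *: x)) ->
  finite_length N (sum_submodule N (cyclic_submodule x)).
Proof.
move=> NS px; exists 1%N => -[|[|n]] // [C [CS NC [y Cy yN]]].
case=> P [PS CP [z Pz zC] PN].
have CN : (C `<=` sum_submodule N (cyclic_submodule x))%classic.
  exact: subset_trans CP (chain_sub PN).
have [m [_ [Nm [r ->] yE]]] := CN _ Cy.
have [m' [_ [Nm' [r' ->] zE]]] := chain_sub PN Pz.
have pr : ~ p r.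
  move=> pr; apply: (yN 1 prime_notin1); rewrite scale1r yE.
  exact: submoduleD NS Nm (px _ pr).
case: (zC r pr).
have -> : r *: z = r' *: y + (r *: m' - r' *: m).
  rewrite yE zE !scalerDr !scalerA [r' * r]mulrC.
  by rewrite [RHS]addrC addrA subrK.
apply: submoduleD => //; first exact: submoduleZ.
by apply: NC; apply: submoduleB => //; exact: submoduleZ.
Qed.

End Chains.

Section LinearLength.
Variables (U V : lmodType R) (f : {linear U -> V}).

Lemma chain_preimage n (C : set V) :
  chain n C (range f) -> chain n (f @^-1` C)%classic setT.
Proof.
elim: n C => //= n IH C [P [PS CP [x Px xC] PM]].
exists (f @^-1` P)%classic; split; last exact: IH.
- exact: submodule_preimage.
- by move=> u /CP.
- have [u _ fu] := chain_sub PM Px; exists u; first by rewrite /preimage /= fu.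
  by move=> s ps; rewrite /preimage /= linearZ /= fu; exact: xC.
Qed.

Lemma chain_image n (C M : set U) : submodule C -> (kernel f `<=` C)%classic ->
  chain n C M -> chain n (f @` C)%classic (f @` M)%classic.
Proof.
elim: n C => [|n IH] C CS kC /=; first exact: image_subset.
case=> P [PS CP [x Px xC] PM]; exists (f @` P)%classic; split.
- exact: submodule_image.
- exact: image_subset.
- exists (f x); first by exists x.
  move=> s ps [y Cy]; rewrite -linearZ => /eqP.
  rewrite eq_sym -subr_eq0 -linearB => /eqP ker; apply: (xC s ps).
  rewrite -[s *: x](subrK y); apply: submoduleD => //; exact: kC.
- by apply: IH => //; exact: subset_trans CP.
Qed.

(** The correspondence theorem for chains: preimages keep steps strict at [p], and so do images once
    the chain starts above the kernel. *)
Lemma chain_range n :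
  chain n (kernel f) setT <-> chain n [set 0]%classic (range f).
Proof.
split; last exact: chain_preimage.
move=> /(chain_image (submodule_kernel f) (@subset_refl _ _)).
apply: chain_subl => _ ->.
exact: (submodule_image f (submodule_kernel f)).1.
Qed.

Lemma finite_length_linear : finite_length [set 0%R]%classic (kernel f) ->
  finite_length [set 0%R]%classic (range f) ->
  finite_length [set 0%R]%classic [set: U]%classic.
Proof.
move=> fk [l lP]; apply: finite_lengthD fk _ => //.
- exact: submodule0.
- exact: submodule_kernel.
- by move=> _ ->; rewrite /kernel /preimage /= linear0.
- by exists l => n /chain_range/lP.
Qed.

Lemma finite_length_range : finite_length [set 0%R]%classic [set: U]%classic ->
  finite_length [set 0%R]%classic (range f).
Proof.
move=> [l lP]; exists l => n /chain_range nP; apply/lP/(chain_subl _ nP).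
by move=> _ ->; rewrite /kernel /preimage /= linear0.
Qed.

Lemma length_linear : finite_length [set 0%R]%classic [set: U]%classic ->
  length [set 0%R]%classic [set: U]%classic =
  (length [set 0%R]%classic (kernel f) + length [set 0%R]%classic (range f))%N.
Proof.
move=> fU; rewrite (@lengthD _ _ (kernel f)) //.
- congr (_ + xget _ _)%N; apply/predeqP => l; rewrite /mkset.
  split=> -[/chain_range c m]; split=> // n /chain_range; exact: m.
- exact: submodule0.
- exact: submodule_kernel.
- by move=> _ ->; rewrite /kernel /preimage /= linear0.
Qed.

(* [f] is injective after localization at [p]. *)
Definition local_injective : Prop :=
  forall u, f u = 0 -> exists2 s, ~ p s & s *: u = 0.

Lemma length_local_injective : finite_length [set 0%R]%classic [set: U]%classic ->
  local_injective ->
  length [set 0%R]%classic (range f) = length [set 0%R]%classic [set: U]%classic.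
Proof.
move=> fU injf; rewrite [RHS]length_linear // (@length_torsion _ _ (kernel f)) //.
by move=> _ ->; rewrite /kernel /preimage /= linear0.
Qed.

End LinearLength.

(** * Lengths of the ring and of free modules at a minimal prime *)

Section FiniteLength.
Hypotheses (noethR : noetherian R) (pmin : minimal_prime p).

(** An ideal [J] maximal among those of finite length is the unit ideal: otherwise adjoin some [x]
    outside [J] with [(J : x)] prime, which still gives finite length. *)
Lemma finite_length_ring : finite_length [set 0%R]%classic [set: R^o]%classic.
Proof.
pose F (J : set R^o) := submodule J /\ finite_length [set 0%R]%classic J.
have [|J []//|J [JS Jfin] Jmax] := @noetherian_maximal R noethR F.
  exists [set 0]%classic; split; first exact: submodule0.
  by apply: torsion_finite_length => _ ->; exists 1; [exact: prime_notin1|rewrite scaler0].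
have [J1|nJ1] := pselect (J 1).
  apply: finite_length_sub Jfin => // a _; rewrite -[a]mulr1.
  exact: (submoduleZ a JS J1).
have [||||x xJ xprime] := @prime_colon R noethR [set 1]%classic J.
- by [].
- by move=> _ _ -> ->; rewrite /= mulr1.
- by [].
- by move=> _ ->.
pose J' : set R^o := sum_submodule J (@cyclic_submodule R R^o x).
have J'S : submodule J' by apply: submodule_sumS => //; exact: submodule_cyclic.
have JJ' : (J `<=` J')%classic by apply: sum_submoduleSl; exists 0; rewrite scale0r.
have J'x : J' x by apply: sum_submoduleSr (cyclic_submodule_id _); exact: JS.1.
have J'fin : finite_length J J'.
  (* Either some [s] outside [p] kills [x] modulo [J] and the new step vanishes at [p], or [(J : x)]
     lies in [p] and equals it by minimality, and the new step has length at most one. *)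
  have [[s [ps Jsx]]|ns] := pselect (exists s, ~ p s /\ J (s * x)).
    apply: torsion_finite_length => _ [y [_ [Jy [r ->] ->]]]; exists s => //.
    rewrite scalerDr; apply: submoduleD => //; first exact: submoduleZ.
    rewrite scalerA mulrC -scalerA; exact: (submoduleZ r JS Jsx).
  apply: finite_length_cyclic => // a pa.
  apply: pmin.2 xprime _ a pa => a Ja; apply: contrapT => pa; apply: ns; by exists a.
case: (xJ 1 erefl); rewrite mul1r; apply: (Jmax J') => //; split=> //.
apply: finite_lengthD Jfin J'fin => //; first exact: submodule0.
move=> _ ->; exact: JS.1.
Qed.

Lemma length_ring_gt0 : (0 < length [set 0%R]%classic [set: R^o]%classic)%N.
Proof.
apply: (@length_gt0 _ _ _ 1) => //; first exact: finite_length_ring.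
by move=> s ps s0; apply: ps; rewrite -[s]mulr1 [s * 1]s0; case: pP => -[].
Qed.

Lemma length_free n : finite_length [set 0%R]%classic [set: 'rV[R]_n]%classic /\
  length [set 0%R]%classic [set: 'rV[R]_n]%classic =
  (n * length [set 0%R]%classic [set: R^o]%classic)%N.
Proof.
elim: n => [|n [IHfin IHlen]].
  have tors (x : 'rV[R]_0) : setT x -> exists2 s, ~ p s & [set 0]%classic (s *: x).
    by exists 1; [exact: prime_notin1|rewrite /= thinmx0].
  by split; [exact: torsion_finite_length|rewrite mul0n length_torsion].
have [f [g [fT gk ginj]]] := free_module_split R n.
have gi : local_injective g.
  by move=> u /ginj->; exists 1; [exact: prime_notin1|rewrite scaler0].
have fin : finite_length [set 0%R]%classic [set: 'rV[R]_n.+1]%classic.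
  apply: (@finite_length_linear _ _ f).
    by rewrite gk; exact: finite_length_range.
  by rewrite fT; exact: finite_length_ring.
split=> //; rewrite (length_linear f fin) fT gk (length_local_injective IHfin gi) IHlen.
by rewrite mulSn addnC.
Qed.

End FiniteLength.
End Length.

(** * Finite generation and existence of finite free resolutions *)

Section FiniteGeneration.
Variable R : comNzRingType.

Definition finitely_generated (V : lmodType R) (N : set V) : Prop :=
  exists n (x : 'I_n -> V), N = range (lincomb x).

Lemma linear_lincomb (U V : lmodType R) (f : {linear U -> V}) n (x : 'I_n -> U) u :
  f (lincomb x u) = lincomb (f \o x) u.
Proof. by rewrite /lincomb linear_sum; apply: eq_bigr => j _; rewrite linearZ. Qed.

Lemma lincomb_submodule (V : lmodType R) (N : set V) n (x : 'I_n -> V) u :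
  submodule N -> (forall j, N (x j)) -> N (lincomb x u).
Proof. by move=> NS Nx; apply: submodule_sum => // j; exact: submoduleZ. Qed.

Lemma finitely_generated_image (U V : lmodType R) (f : {linear U -> V}) (N : set U) :
  finitely_generated N -> finitely_generated (f @` N)%classic.
Proof.
move=> [n [x ->]]; exists n, (f \o x); rewrite predeqE => y; split.
  by move=> [_ [u _ <-] <-]; exists u => //; rewrite linear_lincomb.
by move=> [u _ <-]; exists (lincomb x u); [exists u|rewrite linear_lincomb].
Qed.

(** Lifts of generators of the image, together with generators of the kernel part, generate [N]. *)
Lemma finitely_generated_extension (U V : lmodType R) (f : {linear U -> V}) (N : set U) :
  submodule N -> finitely_generated (f @` N)%classic ->
  finitely_generated (N `&` kernel f)%classic -> finitely_generated N.
Proof.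
move=> NS [n [y yE]] [m [z zE]].
have lift j : exists x, N x /\ f x = y j.
  have [x Nx fx] : (f @` N)%classic (y j).
    by rewrite yE; exists (delta_mx 0 j) => //; exact: lincomb_delta.
  by exists x.
have [x xP] := choice lift.
have Nz j : (N `&` kernel f)%classic (z j).
  by rewrite zE; exists (delta_mx 0 j) => //; exact: lincomb_delta.
pose t (i : 'I_(n + m)) := match split i with inl j => x j | inr j => z j end.
have tE (u : 'rV_n) (v : 'rV_m) : lincomb t (row_mx u v) = lincomb x u + lincomb z v.
  rewrite {1}/lincomb big_split_ord; congr (_ + _); apply: eq_bigr => j _.
    by rewrite row_mxEl /t (unsplitK (inl _ j)).
  by rewrite row_mxEr /t (unsplitK (inr _ j)).
exists (n + m)%N, t; rewrite predeqE => w; split=> [Nw|[u _ <-]]; last first.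
  rewrite -[u]hsubmxK tE; apply: (submoduleD NS); apply: lincomb_submodule => // j.
    by case: (xP j).
  by case: (Nz j).
have [u _ fw] : range (lincomb y) (f w) by rewrite -yE; exists w.
have fxy : f \o x = y by apply: funext => j; case: (xP j).
have [v _ wE] : range (lincomb z) (w - lincomb x u).
  rewrite -zE; split.
    by apply: submoduleB => //; apply: lincomb_submodule => // j; case: (xP j).
  by rewrite /kernel /preimage /mkset linearB linear_lincomb fxy fw subrr.
by exists (row_mx u v) => //; rewrite tE wE addrC subrK.
Qed.

Hypothesis noethR : noetherian R.

Lemma finitely_generated_ideal (J : set R^o) : submodule J -> finitely_generated J.
Proof.
move=> /(noetherian_submodule noethR)[s sP].
exists (size s), (fun j => s`_j : R^o); rewrite predeqE => x; split.
  move=> /sP[c ->]; exists (\row_j c j) => //.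
  by apply: eq_bigr => j _; rewrite mxE.
move=> [u _ <-]; apply/sP; exists (fun i => if insub i is Some j then u 0 j else 0).
by apply: eq_bigr => j _; rewrite valK.
Qed.

Lemma finitely_generated_free n (N : set 'rV[R]_n) : submodule N -> finitely_generated N.
Proof.
elim: n N => [|n IH] N NS.
  exists 0%N, (fun _ => 0); rewrite predeqE => u; split=> _.
    by exists 0 => //; rewrite [LHS]thinmx0 [RHS]thinmx0.
  by rewrite [u]thinmx0; exact: NS.1.
have [f [g [_ gk _]]] := free_module_split R n.
apply: (finitely_generated_extension (f := f)) => //.
  exact/finitely_generated_ideal/submodule_image.
have -> : (N `&` kernel f = g @` (g @^-1` N))%classic.
  rewrite gk predeqE => u; split=> [[Nu [v _ gv]]|[v Nv <-]].
    by exists v => //; rewrite /preimage /mkset gv.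
  by split=> //; exists v.
exact/finitely_generated_image/IH/submodule_preimage.
Qed.

(** The number of rows is packed with the matrix so that [cid] extracts both at once when a
    resolution is built. *)
Lemma submodule_free_matrix n (N : set 'rV[R]_n) : submodule N ->
  exists B : {a & 'M[R]_(a, n)}, forall u, N u <-> exists v, u = v *m projT2 B.
Proof.
move=> /finitely_generated_free[a [x ->]].
have xE v : lincomb x v = v *m (\matrix_i x i).
  by rewrite mulmx_sum_row; apply: eq_bigr => i _; rewrite rowK.
exists (existT _ a (\matrix_i x i)) => u; split=> [[v _ <-]|[v ->]].
  by exists v; rewrite xE.
by exists v => //; rewrite xE.
Qed.

Lemma free_resolution_exists (M : lmodType R) : finitely_generated [set: M]%classic ->
  exists F : free_complex M, free_resolution F.
Proof.
move=> [n [x xE]].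
have ker a (b : lmodType R) (f : {linear 'rV[R]_a -> b}) :=
  cid (submodule_free_matrix (submodule_kernel f)).
(* A state is a matrix with its two sizes. [next] passes to a matrix whose rows generate the left
   kernel, and consecutive sizes agree by computation. *)
pose st0 : {b & {a & 'M[R]_(a, b)}} := existT _ n (projT1 (ker _ _ (lincomb x))).
pose next (t : {b & {a & 'M[R]_(a, b)}}) : {b & {a & 'M[R]_(a, b)}} :=
  existT _ (projT1 (projT2 t)) (projT1 (ker _ _ (mulmxr (projT2 (projT2 t))))).
pose st i := iter i next st0.
exists (@FreeComplex R M (fun i => projT1 (st i)) (fun i => projT2 (projT2 (st i))) x).
split=> [y|u|i u].
- have [u _ <-] : range (lincomb x) y by rewrite -xE.
  by exists u.
- exact: (projT2 (ker _ _ (lincomb x)) u).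
- exact: (projT2 (ker _ _ (mulmxr (projT2 (projT2 (st i))))) u).
Qed.

Lemma finitely_generated_ideal_module (I : ideal R) :
  finitely_generated [set: ideal_module I]%classic.
Proof.
have [n [x xE]] := finitely_generated_ideal (submodule_mem I).
have Ix j : x j \in I.
  suff : range (lincomb x) (x j) by rewrite -xE.
  by exists (delta_mx 0 j) => //; exact: lincomb_delta.
pose y j : ideal_module I := Sub (x j) (Ix j).
exists n, y; rewrite predeqE => z; split=> // _.
have [u _ uz] : range (lincomb x) (val z) by rewrite -xE; exact: valP.
exists u => //; apply: val_inj; rewrite -uz [LHS]linear_lincomb.
by congr (lincomb _ u); apply: funext => j; rewrite /= SubK.
Qed.

End FiniteGeneration.

Lemma chosen_resolutionP (R : comNzRingType) (I : ideal R) :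
  noetherian R -> free_resolution (chosen_resolution (ideal_module I)).
Proof.
move=> noethR.
pose P := [set F : {classic free_complex (ideal_module I)} | free_resolution F]%classic.
suff : P (chosen_resolution (ideal_module I)) by [].
apply: xgetPex.
exact/free_resolution_exists/finitely_generated_ideal_module.
Qed.

(** * Alternating sums of Betti numbers in terms of lengths *)

Section EulerCharacteristic.
Variables (R : comNzRingType) (p : set R^o).
Hypotheses (noethR : noetherian R) (pmin : minimal_prime p).

Let pP : is_prime p := pmin.1.
Local Notation len N := (length p [set 0%R]%classic N).
Local Notation e := (len [set: R^o]%classic).

Lemma length_sub (V : lmodType R) (N M : set V) :
    submodule N -> submodule M -> (N `<=` M)%classic ->
    finite_length p [set 0]%classic M ->
  (len N <= len M)%N.
Proof.
move=> NS MS NM Mfin; rewrite (lengthD pP _ NS MS _ NM Mfin) ?leq_addr //.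
  exact: submodule0.
by move=> _ ->; exact: NS.1.
Qed.

Section ResidueField.
Variables (k : fieldType) (pi : {rmorphism R -> k}).
Hypotheses (pi_surj : forall y, exists x, pi x = y) (ppi : forall x, p x -> pi x = 0).

(* Lifting matrices over [k] that bring [D] to the identity of size its rank [r]
   gives [P], [Q] with [\det (P *m D *m Q)] outside [p], so that [P *m D] embeds
   [R^r] into the image of [D] after localization. *)
Lemma rank_length_range a b (D : 'M[R]_(a, b)) :
  (\rank (map_mx pi D) * e <= len (range (mulmxr D : 'rV_a -> 'rV_b)))%N.
Proof.
have [g gP] := choice pi_surj.
have gK c d (A : 'M_(c, d)) : map_mx pi (map_mx g A) = A.
  by apply/matrixP => i j; rewrite !mxE gP.
set A := map_mx pi D; set r : nat := \rank A.
pose P := map_mx g (pinvmx (col_base A)); pose Q := map_mx g (pinvmx (row_base A)).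
have PDQ : map_mx pi (P *m D *m Q) = 1%:M.
  have : pinvmx (col_base A) *m (col_base A *m row_base A) *m pinvmx (row_base A) = 1%:M.
    by rewrite mulmxA mulVpmx ?col_base_full // mul1mx mulmxVp ?row_base_free.
  by rewrite mulmx_base !map_mxM !gK.
have detP : ~ p (\det (P *m D *m Q)).
  by move=> /ppi/eqP; rewrite -det_map_mx PDQ det1 oner_eq0.
have inj : local_injective p (mulmxr (P *m D) : {linear 'rV[R]_r -> 'rV[R]_b}).
  (* Multiplying [u *m P *m D = 0] by [Q] and then by the adjugate of [P *m D *m Q] shows that the
     determinant kills [u]. *)
  move=> u; rewrite /= => uPD; exists (\det (P *m D *m Q)) => //.
  by rewrite -mul_mx_scalar -mul_mx_adj !mulmxA -[u *m P *m D]mulmxA uPD !mul0mx.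
have [rfin rlen] := length_free pP noethR pmin r.
have [afin _] := length_free pP noethR pmin a.
rewrite -rlen -(length_local_injective pP rfin inj).
apply: length_sub; [exact: submodule_range|exact: submodule_range| |].
  by move=> _ [u _ <-]; exists (u *m P); rewrite //= mulmxA.
exact: finite_length_range.
Qed.

(** Additivity along each map of the resolution, exactness identifying its kernel with the range of
    the next differential. *)
Lemma length_resolution (M : lmodType R) (F : free_complex M) : free_resolution F ->
  (rk F 0 * e = len (range (mulmxr (bd F 0) : 'rV__ -> 'rV__)) + len [set: M]%classic)%N /\
  forall i, (rk F i.+1 * e = len (range (mulmxr (bd F i.+1) : 'rV__ -> 'rV__)) +
                             len (range (mulmxr (bd F i) : 'rV__ -> 'rV__)))%N.
Proof.
move=> [Fsurj F0 FS]; split=> [|i].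
  have [fin <-] := length_free pP noethR pmin (rk F 0).
  rewrite (length_linear pP (lincomb (@aug _ _ F)) fin).
  congr (_ + _)%N; congr (length _ _ _).
    rewrite predeqE => u; split=> [/F0[v ->]|[v _ <-]]; first by exists v.
    by apply/F0; exists v.
  by rewrite predeqE => x; split=> // _; have [u <-] := Fsurj x; exists u.
have [fin <-] := length_free pP noethR pmin (rk F i.+1).
rewrite (length_linear pP (mulmxr (bd F i)) fin); congr (_ + _)%N; congr (length _ _ _).
rewrite predeqE => u; split=> [/FS[v ->]|[v _ <-]]; first by exists v.
by apply/FS; exists v.
Qed.

(** With [w i] the length of the range of the [i]-th differential, [r i] its rank over [k] and
    [t_i = w i - r i * e], one has [e * beta_0 = t_0 + len I] and [e * beta_(i+1) = t_(i+1) + t_i],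
    so the alternating sum telescopes. *)
Lemma alternating_betti_sum (I : ideal R) (N : nat) : exists t : nat,
  e%:Z * \sum_(j < N.+1) (-1) ^+ j.+1 * (betti (ideal_module I) pi j)%:Z =
  - (len [set: ideal_module I]%classic)%:Z - (-1) ^+ N * t%:Z.
Proof.
have FR := chosen_resolutionP I noethR.
rewrite /betti; set F := chosen_resolution _ in FR *.
have [len0 lenS] := length_resolution FR.
pose w i := len (range (mulmxr (bd F i) : 'rV__ -> 'rV__)).
pose r i := \rank (tor_bd pi F i).
have rw i : (r i * e <= w i)%N by exact: rank_length_range.
have b0 : (\rank (tor_cycles pi F 0) - r 0)%:Z = (rk F 0)%:Z - (r 0)%:Z.
  by rewrite mxrank1 subzn // rank_leq_col.
have bS i : (\rank (tor_cycles pi F i.+1) - r i.+1)%:Z =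
            (rk F i.+1)%:Z - (r i)%:Z - (r i.+1)%:Z.
  (* The differentials compose to zero over [k] as well, which makes the truncated subtractions in
     [betti] genuine. *)
  have rr : (r i.+1 + r i <= rk F i.+1)%N.
    apply: mulmx0_rank_max; rewrite -map_mxM.
    suff -> : bd F i.+1 *m bd F i = 0 by apply/matrixP => ? ?; rewrite !mxE rmorph0.
    apply/row_matrixP => j; rewrite row_mul row0; have [_ _ FS] := FR.
    by apply/(FS i); exists (delta_mx 0 j); rewrite -rowE.
  rewrite mxrank_ker -/(r i) -!subzn //.
    by apply: leq_trans rr; exact: leq_addl.
  by rewrite leq_subRL ?(leq_trans _ rr) ?leq_addl // addnC.
exists (w N - r N * e)%N; rewrite -subzn //.
elim: N => [|N IH].
  rewrite big_ord1 expr1 /= b0 mulN1r mulrN mulrBr -!PoszM mulnC len0 PoszD -/(w 0).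
  by rewrite expr0 mul1r [(e * r 0)%N]mulnC; ring.
rewrite big_ord_recr mulrDr IH /= bS.
have := congr1 Posz (lenS N); rewrite -/(w N) -/(w N.+1) !PoszD !PoszM => lenN.
rewrite !exprS; ring: lenN.
Qed.

End ResidueField.

End EulerCharacteristic.

(** * Height, grade and nonzerodivisors *)

Lemma supremum_nat_gt0 (D : set nat) :
  (0 < supremum 0 [set (Posz n)%:E | n in D]%classic)%E <-> exists2 n, D n & (0 < n)%N.
Proof.
split=> [|[n Dn n0]].
  apply: contraPP => noD; have D0 n : D n -> n = 0%N.
    move=> Dn; apply/eqP; rewrite -leqn0 leqNgt; apply/negP => n0.
    by apply: noD; exists n.
  have [[n Dn]|nD] := pselect (exists n, D n).
    have -> : [set (Posz n)%:E | n in D]%classic = [set 0%E]%classic.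
      rewrite predeqE => x; split=> [[i /D0-> <-] //|->].
      by exists n => //; rewrite (D0 n Dn).
    by rewrite supremum1 ltxx.
  have -> : [set (Posz n)%:E | n in D]%classic = set0.
    by rewrite predeqE => x; split=> // -[i Di _]; apply: nD; exists i.
  by rewrite supremum0 ltxx.
apply: (@lt_le_trans _ _ (Posz n)%:E); first by rewrite lte_fin.
apply: ge_supremum_Nmem; last by exists n.
(* [supremum] is meaningful only if a least upper bound exists: it is the largest element of a
   bounded [D], and [+oo] otherwise. *)
have [[b bP]|unbounded] := pselect (exists b, forall i, D i -> (i <= b)%N).
  have exD : exists i, `[<D i>] by exists n; apply/asboolP.
  have leb i : `[<D i>] -> (i <= b)%N by move=> /asboolP/bP.
  case: (ex_maxnP exD leb) => j /asboolP Dj jmax.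
  exists (Posz j)%:E; split=> [_ [i Di <-]|y]; last by apply; exists j.
  by rewrite lee_fin lez_nat; apply/jmax/asboolP.
exists +oo%E; split=> [x _|y yub]; first exact: leey.
case: y yub => [y| |] yub //; last by have := yub _ (ex_intro2 _ _ n Dn erefl).
case: unbounded; exists `|y|%N => i Di.
have := yub _ (ex_intro2 _ _ i Di erefl); rewrite lee_fin => iy.
by rewrite -lez_nat (le_trans iy) // abszE Num.Theory.ler_norm.
Qed.

Section NonzerodivisorsInIdeals.
Variable R : comNzRingType.
Implicit Types (P Q J : set R^o).
Hypothesis noethR : noetherian R.

Definition annihilator_prime P : Prop :=
  is_prime P /\ exists x : R, forall a, P a <-> a * x = 0.

(** Take [J] maximal among ideals whose elements have only finitely many prime annihilators.
    Adjoining some [x] with [q = (J : x)] prime adds at most [q] to the list, so [J] is the unit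
    ideal. *)
Lemma finite_annihilator_primes : exists n (L : nat -> set R^o),
  forall P, annihilator_prime P -> exists2 i, (i < n)%N & P = L i.
Proof.
pose F J := submodule J /\ exists n (L : nat -> set R^o), forall P y, J y ->
  is_prime P -> (forall a, P a <-> a * y = 0) -> exists2 i, (i < n)%N & P = L i.
have [|J []//|J [JS [n [L LP]]] Jmax] := @noetherian_maximal R noethR F.
  exists [set 0]%classic; split; first exact: submodule0.
  by exists 0%N, (fun _ => setT) => P _ -> [_ P1 _] /(_ 1)[_ /(_ (mulr0 _))/P1].
have [J1|nJ1] := pselect (J 1).
  exists n, L => P [PP [x xP]]; apply: LP PP xP.
  rewrite -[x]mulr1; exact: (submoduleZ x JS J1).
have [||||x xJ [_ _ qM]] := @prime_colon R noethR [set 1]%classic J.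
- by [].
- by move=> _ _ -> ->; rewrite /= mulr1.
- by [].
- by move=> _ ->.
have {}xJ : ~ J x by move=> Jx; apply: (xJ 1 erefl); rewrite mul1r.
pose J' : set R^o := sum_submodule J (@cyclic_submodule R R^o x).
have J'S : submodule J' by apply: submodule_sumS => //; exact: submodule_cyclic.
case: xJ; apply: (Jmax J'); last first.
- by apply: sum_submoduleSr (cyclic_submodule_id _); exact: JS.1.
- by apply: sum_submoduleSl; exists 0; rewrite scale0r.
split=> //; pose q : set R^o := fun a => J (a * x).
exists n.+1, (fun i => if (i < n)%N then L i else q) => P y [z [_ [Jz [r ->] yE]]] PP Py.
have [_ P1 PM] := PP.
(* If [t * y] is in [J] for some [t] outside [P], its annihilator is still [P], which is listed.
   Otherwise [P = (J : y) = (J : r x)], and this is [q] because [r] is not in [q]. *)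
have [[t [Pt Jty]]|nJ] := pselect (exists t, ~ P t /\ J (t * y)).
  have [|i lt_in PE] := LP P (t * y) Jty PP; last first.
    by exists i; [exact: ltnW|rewrite lt_in].
  move=> a; rewrite mulrA -Py; split=> [Pa|/PM[]//].
  by rewrite mulrC; apply: (submoduleZ t _ Pa); case: PP.
have sub t : J (t * y) -> P t by move=> Jty; apply: contrapT => Pt; apply: nJ; exists t.
have xy a : J (a * y) <-> J (a * (r * x)).
  rewrite yE mulrDr; have Jaz : J (a * z) by exact: (submoduleZ a JS Jz).
  split=> Ja; last exact: submoduleD JS Jaz Ja.
  by rewrite -[a * (r * x)](addKr (a * z)) addrC; exact: (submoduleB JS Ja Jaz).
exists n; rewrite ?ltnn //; rewrite predeqE => a; split=> [/Py ay|qa].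
  have : J (a * y) by rewrite ay; exact: JS.1.
  move=> /xy; rewrite mulrA => /qM[//|qr].
  by case: P1; apply: sub; apply/xy; rewrite mul1r.
by apply: sub; apply/xy; rewrite mulrCA; exact: (submoduleZ r JS qa).
Qed.

(** If the element [x] avoiding the earlier primes falls into [P = L n], it is corrected by some [y]
    of [J] outside [P] that lies in all the other minimal primes of the list. *)
Lemma minimal_prime_avoidance J n (L : nat -> set R^o) :
    submodule J -> (forall P, minimal_prime P -> ~ (J `<=` P)%classic) ->
  exists2 x, J x & forall i, (i < n)%N -> minimal_prime (L i) -> ~ L i x.
Proof.
move=> JS nJ; elim: n => [|n [x Jx xL]]; first by exists 0; [exact: JS.1|].
have [[Pmin Px]|nPx] := pselect (minimal_prime (L n) /\ L n x); last first.
  exists x => // i; rewrite ltnS leq_eqVlt => /predU1P[->|/xL//] Lmin Lx.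
  by apply: nPx.
set P := L n in Pmin Px *; have [[PS _ PM] Pleast] := Pmin.
have [y [Jy Py yL]] : exists y, [/\ J y, ~ P y &
    forall i, (i < n)%N -> minimal_prime (L i) -> L i <> P -> L i y].
  elim: {1}n => [|m [y [Jy Py yL]]].
    have [y yP] : exists y, ~ (J y -> P y).
      apply: contrapT => ny; apply: (nJ P Pmin) => y.
      by apply: contrapT => yP; apply: ny; exists y.
    by exists y; split=> //; apply: contrapT => nJy; apply: yP.
  have [[Lmin LP]|nL] := pselect (minimal_prime (L m) /\ L m <> P); last first.
    exists y; split=> // i; rewrite ltnS leq_eqVlt => /predU1P[->|/yL//] Lmin LP.
    by case: nL.
  (* Distinct minimal primes are incomparable; multiplying [y] by [a] brings it into [L m] while
     keeping it outside [P]. *)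
  have [a La Pa] : exists2 a, L m a & ~ P a.
    apply: contrapT => na; apply: LP.
    have LmP : (L m `<=` P)%classic.
      by move=> a La; apply: contrapT => Pa; apply: na; exists a.
    by rewrite eqEsubset; split=> //; apply: Pleast LmP; case: Lmin.
  exists (a * y); split=> [||i].
  - exact: (submoduleZ a JS Jy).
  - by case/PM.
  rewrite ltnS leq_eqVlt => /predU1P[->|lt_im] Limin LiP.
    by rewrite mulrC; case: Limin => -[LS _ _] _; exact: (submoduleZ y LS La).
  by case: (Limin) => -[LS _ _] _; exact: (submoduleZ a LS (yL _ lt_im Limin LiP)).
exists (x + y); first exact: submoduleD.
move=> i; rewrite ltnS leq_eqVlt => /predU1P[->|lt_in] Limin Lixy.
  by apply: Py; rewrite -[y](addKr x) addrC; exact: submoduleB.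
have [LiP|LiP] := pselect (L i = P).
  by apply: (xL i lt_in Limin); rewrite LiP.
apply: (xL i lt_in Limin); rewrite -[x](addrK y).
by case: (Limin) => -[LS _ _] _; apply: submoduleB => //; exact: yL.
Qed.

Lemma nonzerodivisor_exists J :
    (forall P, annihilator_prime P -> minimal_prime P) ->
    submodule J -> (forall P, minimal_prime P -> ~ (J `<=` P)%classic) ->
  exists2 x, J x & forall a : R, a * x = 0 -> a = 0.
Proof.
move=> assmin JS nJ; have [n [L LP]] := finite_annihilator_primes.
have [x Jx xL] := minimal_prime_avoidance n L JS nJ.
exists x => // a ax; apply: contrapT => a0.
(* The annihilator of a nonzero [a] with [a * x = 0] lies in the prime annihilator of a multiple
   [c * a], which therefore contains [x]. *)
have [||||c ca cP] := @prime_colon R noethR [set 1]%classic (fun b => b * a = 0).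
- by [].
- by move=> _ _ -> ->; rewrite /= mulr1.
- by split=> [|b u v ua va]; rewrite ?mul0r // mulrDl -mulrA ua va mulr0 addr0.
- by move=> _ ->; rewrite mul1r.
have assP : annihilator_prime (fun b => b * c * a = 0).
  by split=> //; exists (c * a) => b; rewrite mulrA.
have [i lt_in PE] := LP _ assP; apply: (xL i lt_in); rewrite -PE; first exact: assmin.
by rewrite -mulrA mulrCA [x * a]mulrC ax mulr0.
Qed.

(** A minimal prime [Q] below [P] is associated too, so both have the same height. Were [Q] strictly
    smaller, [P] would have positive height, but no prime lies strictly below [Q]. *)
Lemma unmixed_annihilator_prime_minimal P :
  unmixed R^o -> annihilator_prime P -> minimal_prime P.
Proof.
move=> unm assP; have [PP [x xP]] := assP.
have [Q Qmin QP] := prime_below PP; have [QQ Qleast] := Qmin.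
have [y yQ] := minimal_prime_ann noethR Qmin.
have [P' PE] := prime_idealr_of_is_prime PP; have [Q' QE] := prime_idealr_of_is_prime QQ.
suff PQ : (P `<=` Q)%classic by have -> : P = Q by rewrite eqEsubset.
apply: contrapT => nPQ.
have hE : height P' = height Q'.
  by apply: unm; [exists x => a; rewrite PE xP|exists y => a; rewrite QE yQ].
have : (0 < height P')%E.
  apply/supremum_nat_gt0; exists 1%N => //.
  exists (fun i => if i is 0 then Q' else P'); split=> // -[|//] _.
  split; first by move=> a /QE/QP/PE.
  by move=> sub; apply: nPQ => a /PE/sub/QE.
rewrite hE => /supremum_nat_gt0[[|h] [q [qinc qE]] // _].
have [qsub nqsub] := qinc h (leqnn _); apply: nqsub => a; rewrite qE => /QE.
have q'P : is_prime (fun a : R^o => a \in q h) by exact: is_prime_prime_idealr.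
by apply: (Qleast _ q'P) => b /qsub; rewrite qE => /QE.
Qed.

(** The first term of a regular sequence is a nonzerodivisor, its colon condition being over the
    empty span. Conversely, a nonzerodivisor in a proper ideal is a regular sequence of length one;
    the unit ideal, of grade [+oo], contains [1]. *)
Lemma grade_gt0 (I : ideal R) :
  (0 < grade I)%E <-> exists2 x, x \in I & forall a : R, a * x = 0 -> a = 0.
Proof.
rewrite /grade; case: ifPn => [I1|nI1].
  split=> [_|_]; last exact: ltry.
  by exists 1 => // a; rewrite mulr1.
rewrite -(image_comp (fun s : seq R => size s) (fun n => (Posz n)%:E)).
rewrite supremum_nat_gt0; split=> [[_ [s [[sreg _] sI] <-] s0]|[x xI xreg]].
  exists s`_0; first exact/sI/mem_nth.
  move=> a as0; have : span_ideal (take 0 s) a.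
    apply: sreg s0 _ _; rewrite as0 take0; exists (fun _ => 0).
    by rewrite big_ord0.
  by rewrite take0 => -[c ->]; rewrite big_ord0.
exists 1%N => //; exists [:: x] => //; split=> [|y]; last by rewrite inE => /eqP->.
split=> [[|//] _ r [c]|[c]].
  by rewrite /= big_ord0 => /xreg->; exists c; rewrite big_ord0.
rewrite big_ord1 /= => x1; move: nI1; rewrite x1 => /negP; apply.
exact: (submoduleZ (c 0%N) (submodule_mem I) xI).
Qed.

End NonzerodivisorsInIdeals.

(** * Comparison of the lengths of an ideal and of the ring *)

Section IdealLength.
Variables (R : comNzRingType) (p : set R^o).
Hypotheses (noethR : noetherian R) (pmin : minimal_prime p).

Local Notation len N := (length p [set 0%R]%classic N).
Local Notation e := (len [set: R^o]%classic).

Let pP : is_prime p := pmin.1.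
Let Rfin : finite_length p [set 0]%classic [set: R^o]%classic :=
  finite_length_ring pP noethR pmin.

Lemma length_ideal_module (I : ideal R) :
  len [set: ideal_module I]%classic = len (fun x : R^o => x \in I).
Proof.
pose f : {linear ideal_module I -> R^o} := val.
have finj : local_injective p f.
  move=> z fz0; exists 1; first exact: prime_notin1 pP.
  by rewrite scale1r; apply: val_inj; rewrite [LHS]fz0 linear0.
have fI : range f = (fun x : R^o => x \in I).
  rewrite predeqE => x; split=> [[z _ <-]|xI]; first exact: valP.
  by exists (Sub x xI) => //; exact: SubK.
rewrite -fI -(length_local_injective pP _ finj) //.
apply: (finite_length_linear pP (f := f)).
  by apply: torsion_finite_length => z fz0; apply: finj.
exact: finite_length_sub Rfin.
Qed.

Lemma length_ideal_le (I : ideal R) : (len [set: ideal_module I]%classic <= e)%N.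
Proof.
by rewrite length_ideal_module; apply: length_sub => //; exact: submodule_mem.
Qed.

(** Equal lengths force [R / I] to have length zero at [p], whereas for [I] inside [p] the class of
    [1] survives there. *)
Lemma length_ideal_notin (I : ideal R) : len [set: ideal_module I]%classic = e ->
  ~ ((fun x : R^o => x \in I) `<=` p)%classic.
Proof.
rewrite length_ideal_module => lenI Ip; have IS := submodule_mem I.
have := lengthD pP (@submodule0 _ _) IS (@submoduleT _ R^o) _ _ Rfin.
rewrite lenI => /(_ _ _)/eqP; rewrite -[X in X == _]addn0 eqn_add2l => lenRI.
have : (0 < length p (fun x : R^o => x \in I) [set: R^o]%classic)%N.
  apply: (@length_gt0 _ _ _ _ _ 1) => //.
    apply: finite_length_sub Rfin => // _ ->; exact: IS.1.
  by move=> s ps Is; apply: ps; rewrite -[s]mulr1; apply: Ip.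
by rewrite -(eqP (lenRI _ _)) // => _ ->; exact: IS.1.
Qed.

(** Multiplication by [x] embeds the free module of rank one into [I]. *)
Lemma length_ideal_nonzerodivisor (I : ideal R) (x : R) :
  x \in I -> (forall a : R, a * x = 0 -> a = 0) ->
  len [set: ideal_module I]%classic = e.
Proof.
move=> xI xreg; apply/eqP; rewrite eqn_leq length_ideal_le /= length_ideal_module.
pose f : {linear 'rV[R]_1 -> R^o} := lincomb (fun _ => x : R^o).
have fE u : f u = u 0 0 * x by rewrite /f /= /lincomb big_ord1.
have finj : local_injective p f.
  move=> u; rewrite fE => /xreg u0; exists 1; first exact: prime_notin1 pP.
  by rewrite scale1r; apply/rowP => i; rewrite ord1 u0 mxE.
have [fin len1] := length_free pP noethR pmin 1.
rewrite -[e]mul1n -len1 -(length_local_injective pP fin finj).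
apply: length_sub; [by []|exact: (submodule_range f)|exact: submodule_mem| |].
  by move=> _ [u _ <-]; rewrite fE; exact: (submoduleZ _ (submodule_mem I) xI).
exact: finite_length_sub Rfin.
Qed.

End IdealLength.

(** * Minimal primes of the local ring and the three assertions *)

Lemma local_with_sub (R : comNzRingType) (m : idealr R) (P : set R^o) :
  noetherian R -> local_with m -> submodule P -> ~ P 1 -> forall x, P x -> x \in m.
Proof.
move=> noethR [_ muniq] PS P1 x Px.
(* A maximal member among the proper ideals containing [P] is a maximal ideal, hence is [m]. *)
have [||J [JS J1 PJ] Jmax] := @noetherian_maximal R noethR
    (fun J => [/\ submodule J, ~ J 1 & (P `<=` J)%classic]).
- by exists P; split.
- by move=> J [].
have [J' JE] := idealr_of_submodule JS J1.
have J'max : maximal_ideal J'.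
  move=> K J'K y; apply/idP/idP; last exact: J'K.
  move=> yK; apply/JE; apply: (Jmax (fun y : R^o => y \in K)) => //.
    split; first exact: (submodule_idealr K); first by rewrite idealr1.
    by move=> z /PJ/JE/J'K.
  by move=> z /JE/J'K.
by rewrite -(muniq _ J'max); apply/JE/PJ.
Qed.

Lemma minimal_prime_exists (R : comNzRingType) : noetherian R ->
  exists P : set R^o, minimal_prime P.
Proof.
move=> noethR; have [||||x _ xP] := @prime_colon R noethR [set 1]%classic [set 0]%classic.
- by [].
- by move=> _ _ -> ->; rewrite /= mulr1.
- exact: submodule0.
- by move=> _ -> /eqP; rewrite oner_eq0.
by have [Q Qmin _] := prime_below xP; exists Q.
Qed.

Theorem proposition1p1 (R : comNzRingType) (m : idealr R) (k : fieldType)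
    (pi : {rmorphism R -> k}) (I : ideal R)
    (noethR : noetherian R) (localR : local_with m)
    (resk : residue_map m pi) :
  let beta (j : nat) : int := Posz (betti (ideal_module I) pi j) in
  [/\ (forall n : nat, -1 <= \sum_(j < (2 * n + 1).+1) (-1) ^+ j.+1 * beta j)
        /\ -1 <= beta 1%N - beta 0%N,
      unmixed R^o ->
        (exists n : nat,
           \sum_(j < (2 * n + 1).+1) (-1) ^+ j.+1 * beta j = -1) ->
        (0 < grade I)%E
    & (0 < grade I)%E ->
        forall n : nat, \sum_(j < (2 * n).+1) (-1) ^+ j.+1 * beta j <= -1].
Proof.
move=> beta.
have ppi p : minimal_prime p -> forall x, p x -> pi x = 0.
  move=> [[pS p1 _] _] x px; apply/resk.2; exact: local_with_sub px.
have sumE p (pmin : minimal_prime p) :=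
  alternating_betti_sum noethR pmin resk.1 (ppi p pmin) I.
have e0 p (pmin : minimal_prime p) :
    0 < (length p [set 0%R]%classic [set: R^o]%classic)%:Z :> int.
  by rewrite ltz_nat; exact: length_ring_gt0 pmin.1 noethR pmin.
have le_e p (pmin : minimal_prime p) := length_ideal_le noethR pmin I.
(* One minimal prime suffices for both inequalities; the equality case runs over all of them. *)
have [p pmin] := minimal_prime_exists noethR.
have sum_ge n : -1 <= \sum_(j < (2 * n + 1).+1) (-1) ^+ j.+1 * beta j.
  have [t tE] := sumE p pmin (2 * n + 1)%N.
  (* Multiplied by [e > 0], the claim reads [- e <= - len I + t], where [len I <= e] and
     [t >= 0]. *)
  rewrite -(Num.Theory.ler_pM2l (e0 p pmin)) tE mulrN1.
  have := le_e p pmin; rewrite addn1 exprS exprM sqrrN !expr1n; lia.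
split; first split=> //.
- have := sum_ge 0%N; rewrite muln0 add0n big_ord_recr big_ord1 /= expr1 sqrrN expr1n.
  by rewrite mulN1r mul1r addrC.
- move=> unm [n sumn]; apply/grade_gt0.
  apply: (@nonzerodivisor_exists R noethR (fun x : R^o => x \in I)).
  + by move=> P; exact: unmixed_annihilator_prime_minimal.
  + exact: submodule_mem.
  move=> P Pmin; apply: (length_ideal_notin noethR Pmin).
  (* Equality gives [len I = e + t], so [len I <= e] forces [len I = e] at every minimal prime. *)
  have [t] := sumE P Pmin (2 * n + 1)%N.
  rewrite sumn mulrN1 addn1 exprS exprM sqrrN !expr1n.
  have := le_e P Pmin; lia.
- move=> /grade_gt0[x xI xreg] n; have [t tE] := sumE p pmin (2 * n)%N.
  rewrite -(Num.Theory.ler_pM2l (e0 p pmin)) tE mulrN1.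
  (* Now [len I = e], and the sum times [e] is [- e - t]. *)
  rewrite (length_ideal_nonzerodivisor noethR pmin xI xreg) exprM sqrrN !expr1n; lia.
Qed.
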